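(* There is an absolute constant $\eta > 0$ such that the following holds. Let $m \geq 3$ and $n$ be positive integers, let $Q_1, \ldots, Q_m$ be linearly independent $n \times n$ real symmetric matrices and let $q_i: \mathbb{R}^n \longrightarrow \mathbb{R}$, $q_i(x) = \langle Q_i x, x \rangle$ for $i = 1, \ldots, m$, be the corresponding quadratic forms. Suppose that $$\left\| \sum_{i=1}^m A_i^2 \right\|_{\mathrm{op}} \leq \frac{\eta}{m}$$ for some (equivalently, for any) orthonormal basis $A_1, \ldots, A_m$ of the subspace $\mathrm{span}(Q_1, \ldots, Q_m)$. Then the system of quadratic equations $$q_i(x) = \mathrm{trace}\, Q_i \quad \text{for} \quad i = 1, \ldots, m$$ has a solution $x \in \mathbb{R}^n$.
   Context: $\langle x, y\rangle = \sum_{i=1}^n \xi_i \eta_i$ is the standard scalar product of $x=(\xi_1,\ldots,\xi_n)$ and $y=(\eta_1,\ldots,\eta_n)$ in $\mathbb{R}^n$. The space of $n \times n$ real symmetric matrices is a Euclidean space with inner product $\langle X, Y \rangle = \mathrm{trace}(XY)$, and ''orthonormal basis'' refers to this inner product: $\mathrm{trace}(A_i A_j) = 1$ if $i = j$ and $0$ if $i \neq j$. The matrix $A_1^2+\ldots+A_m^2$ does not depend on the choice of an orthonormal basis of the subspace. For a real symmetric matrix $Q$, $\|Q\|_{\mathrm{op}}$ is the operator norm, that is, the largest absolute value of an eigenvalue of $Q$. ''Absolute constant'' means that $\eta$ does not depend on $m$, $n$ or the matrices. *)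

(* Defs.v *)
From mathcomp Require Import all_boot all_order all_algebra.
From mathcomp Require Import classical_sets reals.
Set Implicit Arguments.
Unset Strict Implicit.
Unset Printing Implicit Defensive.
Import Order.TTheory GRing.Theory Num.Theory.
Local Open Scope classical_set_scope.
Local Open Scope ring_scope.

Definition dotp (R : realType) (n : nat) (x y : 'cV[R]_n) : R :=
  \sum_(i < n) x i 0 * y i 0.

Definition qform (R : realType) (n : nat) (Q : 'M[R]_n) (x : 'cV[R]_n) : R :=
  dotp (Q *m x) x.

(* Meant for symmetric Q and n > 0: the set of eigenvalues is then finite and
   nonempty, so that the supremum is a maximum. *)
Definition opnorm (R : realType) (n : nat) (Q : 'M[R]_n) : R :=
  sup [set `|a| | a in [set a : R | eigenvalue Q a]].

Definition mx_orthonormal_basis (R : realType) (m n : nat)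
    (V : {vspace 'M[R]_n}) (A : m.-tuple 'M[R]_n) : Prop :=
  basis_of V A /\
  forall i j : 'I_m, \tr (tnth A i *m tnth A j) = (i == j)%:R.

Definition sum_squares (R : realType) (m n : nat) (A : m.-tuple 'M[R]_n) :
    'M[R]_n :=
  \sum_(i < m) tnth A i *m tnth A i.

(* Main.v *)
(* If A_1, ..., A_m is an orthonormal basis, S = sum A_k^2 and F_k(x) =
   <A_k x, x> - tr A_k, then for a uniformly random vector of signs x the
   variance of <Bx, x> is at most 2 ||B||_F^2. Hence |F(x)|^2 has mean at most
   2m, and the Gram matrix G(x) = (<A_i x, A_j x>), whose mean is I, satisfies
   E ||G(x) - I||_F^2 <= 2 sum_ij ||A_j A_i||_F^2 <= 2 m ||S||_op <= 2 eta.
   So some x0 has |F(x0)|^2 <= 4m and G(x0) close to I. Correcting x0 by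
   y(s) = sum_k s_k A_k x0 turns F = 0 into
     F(x0) + 2 G(x0) s + (<A_k y(s), y(s)>)_k = 0,
   where the quadratic term is controlled by
   sum_k <A_k u, v>^2 <= ||S||_op |u|^2 |v|^2; this is a fixed point equation
   for a contraction of the ball |s|^2 <= 4m. *)
Require Import Defs.
From mathcomp Require Import all_boot all_order all_algebra.
From mathcomp Require Import ring lra.
From mathcomp Require Import boolp classical_sets reals topology normedtype.
From mathcomp Require Import derive polyrcf.
Set Implicit Arguments.
Unset Strict Implicit.
Unset Printing Implicit Defensive.
Import Order.TTheory GRing.Theory Num.Theory.
Import numFieldTopology.Exports.
Local Open Scope ring_scope.

(** * Scalar product and Frobenius norm *)

Lemma dotpE (R : realType) n (x y : 'cV[R]_n) : dotp x y = (x^T *m y) 0 0.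
Proof. by rewrite mxE; apply: eq_bigr => i _; rewrite mxE. Qed.

Lemma dotpC (R : realType) n (x y : 'cV[R]_n) : dotp x y = dotp y x.
Proof. by apply: eq_bigr => i _; rewrite mulrC. Qed.

Lemma dotpDl (R : realType) n (x y z : 'cV[R]_n) :
  dotp (x + y) z = dotp x z + dotp y z.
Proof. by rewrite !dotpE linearD mulmxDl mxE. Qed.

Lemma dotpDr (R : realType) n (x y z : 'cV[R]_n) :
  dotp z (x + y) = dotp z x + dotp z y.
Proof. by rewrite !(dotpC z) dotpDl. Qed.

Lemma dotpZl (R : realType) n a (x z : 'cV[R]_n) :
  dotp (a *: x) z = a * dotp x z.
Proof. by rewrite !dotpE linearZ -scalemxAl mxE. Qed.

Lemma dotpZr (R : realType) n a (x z : 'cV[R]_n) :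
  dotp z (a *: x) = a * dotp z x.
Proof. by rewrite !(dotpC z) dotpZl. Qed.

Lemma dotp0l (R : realType) n (z : 'cV[R]_n) : dotp 0 z = 0.
Proof. by rewrite -(scale0r 0) dotpZl mul0r. Qed.

Lemma dotpNl (R : realType) n (x z : 'cV[R]_n) : dotp (- x) z = - dotp x z.
Proof. by rewrite -scaleN1r dotpZl mulN1r. Qed.

Lemma dotpNr (R : realType) n (x z : 'cV[R]_n) : dotp z (- x) = - dotp z x.
Proof. by rewrite -scaleN1r dotpZr mulN1r. Qed.

Definition dotp_lin := (dotpDl, dotpDr, dotpZl, dotpZr, dotpNl, dotpNr).

Lemma dotp_suml (R : realType) n (I : finType) (F : I -> 'cV[R]_n) z :
  dotp (\sum_i F i) z = \sum_i dotp (F i) z.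
Proof.
rewrite dotpE raddf_sum mulmx_suml summxE.
by apply: eq_bigr => i _; rewrite dotpE.
Qed.

Lemma dotp_mulmxl (R : realType) p n (A : 'M[R]_(p, n)) x y :
  dotp (A *m x) y = dotp x (A^T *m y).
Proof. by rewrite !dotpE trmx_mul mulmxA. Qed.

Lemma dotp_ge0 (R : realType) n (x : 'cV[R]_n) : 0 <= dotp x x.
Proof. by apply: sumr_ge0 => i _; rewrite -expr2 sqr_ge0. Qed.

Lemma dotp_eq0 (R : realType) n (x : 'cV[R]_n) : dotp x x = 0 -> x = 0.
Proof.
move=> /eqP; rewrite psumr_eq0 => [/allP xx0|i _]; last first.
  by rewrite -expr2 sqr_ge0.
apply/colP => i; rewrite mxE; apply/eqP.
by have := xx0 i (mem_index_enum _); rewrite /= -expr2 sqrf_eq0.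
Qed.

Lemma dotp_CauchySchwarz (R : realType) n (x y : 'cV[R]_n) :
  dotp x y ^+ 2 <= dotp x x * dotp y y.
Proof.
have [y0|y0] := eqVneq (dotp y y) 0.
  by rewrite (dotp_eq0 y0) dotpC !dotp0l mulr0 expr0n.
have y_gt0 : 0 < dotp y y by rewrite lt_def y0 dotp_ge0.
have := dotp_ge0 (dotp y y *: x - dotp x y *: y).
rewrite !dotp_lin (dotpC y x).
set a := dotp x x; set b := dotp x y; set c := dotp y y in y_gt0 *.
rewrite (_ : _ + _ = c * (a * c - b ^+ 2)); last by ring.
by rewrite pmulr_rge0 // subr_ge0.
Qed.

Lemma dotp_sqrD (R : realType) n (x y : 'cV[R]_n) :
  dotp (x + y) (x + y) <= 2 * dotp x x + 2 * dotp y y.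
Proof.
have := dotp_ge0 (x - y); rewrite !dotp_lin (dotpC y x); lra.
Qed.

(** The square of the Frobenius norm; all norms are kept squared, which keeps the estimates
    polynomial. *)
Definition frob (R : realType) p n (M : 'M[R]_(p, n)) : R :=
  \sum_i \sum_j M i j ^+ 2.

Lemma dotp_mulmx_frob (R : realType) p n (M : 'M[R]_(p, n)) x :
  dotp (M *m x) (M *m x) <= frob M * dotp x x.
Proof.
rewrite /frob mulr_suml; apply: ler_sum => i _.
have -> : (M *m x) i 0 = dotp (row i M)^T x.
  by rewrite mxE; apply: eq_bigr => j _; rewrite !mxE.
rewrite -expr2 (le_trans (dotp_CauchySchwarz _ _)) //.
rewrite ler_wpM2r ?dotp_ge0 //; apply: ler_sum => j _.
by rewrite !mxE expr2.
Qed.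

(** * Continuity and minima on spherical shells *)

Lemma continuous_dotp (R : realType) (T : topologicalType) n
    (u v : T -> 'cV[R]_n) :
  (forall i, continuous (fun t => u t i 0)) ->
  (forall i, continuous (fun t => v t i 0)) ->
  continuous (fun t => dotp (u t) (v t)).
Proof.
move=> uc vc; apply: continuous_big => [|i _ t].
  exact: (@add_continuous R^o).
by apply: cvgM; [exact: uc|exact: vc].
Qed.

Lemma continuous_mulmx (R : realType) (T : topologicalType) p n
    (M : 'M[R]_(p, n)) (u : T -> 'cV[R]_n) :
  (forall i, continuous (fun t => u t i 0)) ->
  forall i, continuous (fun t => (M *m u t) i 0).
Proof.
move=> uc i.
have -> : (fun t => (M *m u t) i 0) = (fun t => dotp (row i M)^T (u t)).
  by apply/funext => t; rewrite mxE; apply: eq_bigr => j _; rewrite !mxE.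
by apply: continuous_dotp => // j; exact: cst_continuous.
Qed.

Lemma continuous_trmx_coord (R : realType) n (i : 'I_n) :
  continuous (fun t : 'rV[R]_n => t^T i 0).
Proof.
have -> : (fun t : 'rV[R]_n => t^T i 0) = (fun t => t 0 i).
  by apply/funext => t; rewrite mxE.
exact: coord_continuous.
Qed.

(** A shell is compact. It is used with [a = b = 1] (the unit sphere, for Rayleigh quotients) and
    with [a = 0] (a ball, for fixed points); [x] witnesses that it is nonempty. *)
Lemma dotp_shell_EVT_min (R : realType) n (f : 'cV[R]_n -> R) (a b : R)
    (x : 'cV_n) :
  continuous (fun t : 'rV_n => f t^T) -> a <= dotp x x <= b ->
  exists2 c : 'cV_n, a <= dotp c c <= b &
    forall t, a <= dotp t t <= b -> f c <= f t.
Proof.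
move=> fc xab; pose g (t : 'rV[R]_n) := dotp t^T t^T.
have gc : continuous g.
  by apply: continuous_dotp => i; exact: continuous_trmx_coord.
pose A := [set t : 'rV[R]_n | a <= g t <= b]%classic.
have [|||c] := @EVT_min_rV _ _ (fun t => f t^T) A; last first.
- rewrite inE => cA cmin; exists c^T => // t tab.
  by have := cmin t^T; rewrite inE trmxK /A/= /g trmxK; apply.
- exact: continuous_subspaceT.
- apply: bounded_closed_compact.
    (* Each coordinate has square at most [b <= (1 + b)^2], so [1 + b] bounds the sup norm without a
       square root. *)
    exists (1 + b); split; first exact: num_real.
    move=> M bM t /andP[_ tb]; rewrite /= [leLHS]/Num.norm/= mx_normrE.
    have b0 : 0 <= b := le_trans (dotp_ge0 _) tb.
    apply/bigmax_leP; split=> [|[i j] _ /=]; first lra.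
    rewrite ord1 (le_trans _ (ltW bM)) //.
    have : `|t 0 j| ^+ 2 <= b.
      apply: le_trans tb; rewrite real_normK ?num_real //.
      rewrite /g /dotp (bigD1 j) //=.
      by rewrite !mxE -expr2 lerDl sumr_ge0 // => k _; rewrite -expr2 sqr_ge0.
    have := normr_ge0 (t 0 j); nra.
  rewrite (_ : A = (g @^-1` [set t | a <= t]
      `&` g @^-1` [set t | t <= b])%classic).
    apply: closedI; apply: preimage_closed;
      by [move=> ? _; exact: gc|exact: closed_ge|exact: closed_le].
  by apply/predeqP => t; split=> [/andP|/= [ta tb]] //; apply/andP.
- by exists x^T; rewrite /A/= /g trmxK.
Qed.

(** * Operator norm of a symmetric matrix *)

(** The supremum is an upper bound only once the set is known to be bounded; the Cauchy bound on the
    roots of the characteristic polynomial provides this. *)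
Lemma eigenvalue_le_opnorm (R : realType) n (S : 'M[R]_n) a :
  eigenvalue S a -> `|a| <= opnorm S.
Proof.
move=> Sa; apply: ub_le_sup; last by exists a.
exists (cauchy_bound (char_poly S)) => _ [b Sb <-]; apply/ltW/cauchy_boundP.
  exact/monic_neq0/char_poly_monic.
by apply/rootP; rewrite -eigenvalue_root_char.
Qed.

Lemma exists_normalized (R : realType) n (t : 'cV[R]_n) :
  t != 0 -> exists2 k, k != 0 & dotp (k *: t) (k *: t) = 1.
Proof.
move=> t0; have tt0 : 0 < dotp t t.
  by rewrite lt_def dotp_ge0 andbT; apply: contraNneq t0 => /dotp_eq0 ->.
exists (Num.sqrt (dotp t t))^-1; first by rewrite invr_eq0 gt_eqF ?sqrtr_gt0.
rewrite !dotp_lin -[X in _ * (_ * X)]sqr_sqrtr ?dotp_ge0 //.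
by field; rewrite gt_eqF ?sqrtr_gt0.
Qed.

(** A maximiser [v] of the quadratic form on the unit sphere is an eigenvector, and its eigenvalue
    [mu] is the maximum of the form there. *)
Lemma dotp_mulmx_le_opnorm (R : realType) n (S : 'M[R]_n) u :
  S^T = S -> dotp (S *m u) u <= opnorm S * dotp u u.
Proof.
move=> S_sym; have [->|u0] := eqVneq u 0.
  by rewrite mulmx0 !dotp0l mulr0.
have [k _ ku1] := exists_normalized u0.
have [||v vv1 vmin] :=
  @dotp_shell_EVT_min R n (fun t => - dotp (S *m t) t) 1 1 (k *: u).
- have cS : continuous (fun t : 'rV[R]_n => dotp (S *m t^T) t^T).
    have ct i : continuous (fun t : 'rV[R]_n => t^T i 0).
      exact: continuous_trmx_coord.
    by apply: continuous_dotp => //; exact: continuous_mulmx.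
  by move=> t; exact: (@continuousN R R^o _ _ t (cS t)).
- by rewrite ku1 lexx.
have {}vv1 : dotp v v = 1 by apply/esym/eqP; rewrite eq_le.
pose mu := dotp (S *m v) v.
have Smu t : dotp (S *m t) t <= mu * dotp t t.
  have [->|t0] := eqVneq t 0.
    by rewrite mulmx0 !dotp0l mulr0.
  have [h h0 ht1] := exists_normalized t0.
  have := vmin (h *: t); rewrite ht1 lexx -scalemxAr lerN2 => /(_ isT).
  move: ht1; rewrite !dotp_lin -/mu !mulrA -!expr2 => ht1 le_mu.
  have h2 : 0 < h ^+ 2 by rewrite lt_def sqrf_eq0 h0 sqr_ge0.
  by rewrite -(ler_pM2l h2) mulrCA ht1 mulr1.
suff Sv : S *m v = mu *: v.
  apply: (le_trans (Smu u)); rewrite ler_wpM2r ?dotp_ge0 //.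
  apply: le_trans (ler_norm _) (eigenvalue_le_opnorm _).
  (* [eigenvalue] refers to row vectors; symmetry of [S] lets [v] be transposed. *)
  apply/eigenvalueP; exists v^T.
    by rewrite -{1}S_sym -trmx_mul Sv linearZ.
  apply: contra_eq_neq vv1 => /(congr1 trmx); rewrite trmxK trmx0 => ->.
  by rewrite dotp0l eq_sym oner_eq0.
(* [mu I - S] is positive semidefinite and its form vanishes at [v], so
   [S v = mu v]. *)
have [w wE] : exists w, w = mu *: v - S *m v by eexists.
apply/eqP; rewrite eq_sym -subr_eq0 -wE; apply/eqP/dotp_eq0.
set W := dotp w w.
pose K := mu * dotp w w - dotp (S *m w) w.
have K0 : 0 <= K by rewrite subr_ge0.
have SvwC : dotp (S *m w) v = dotp (S *m v) w.
  by rewrite dotp_mulmxl S_sym dotpC.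
have WE : W = mu * dotp v w - dotp (S *m v) w by rewrite /W {1}wE !dotp_lin.
(* Perturbing [v] to [v - e w] gives a linear term in [e] dominated by a quadratic one for every
   [e], which forces [W = 0]. Below, [e = W / (K + 1)], where [K + 1] stays positive even if
   [K = 0]. *)
have quad e : e * (2 * W) <= e ^+ 2 * K.
  have := Smu (v - e *: w); rewrite mulmxBr -scalemxAr !dotp_lin.
  rewrite SvwC (dotpC w v) vv1 -/mu /K -/W; move: WE; nra.
have := quad (W / (K + 1)).
have K1 : 0 < K + 1 by lra.
rewrite expr_div_n -subr_ge0.
rewrite (_ : _ - _ = - (W ^+ 2 * ((K + 2) / (K + 1) ^+ 2))); last first.
  by field; rewrite gt_eqF.
rewrite oppr_ge0 pmulr_lle0; last by rewrite divr_gt0 ?exprn_gt0 //; lra.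
by move=> W2; apply/eqP; rewrite -sqrf_eq0 eq_le W2 sqr_ge0.
Qed.

(** * Contractions of a ball and correction of an approximate solution *)

(** The fixed point is found by minimising the displacement over the compact ball. Both [q] and [r]
    refer to squared lengths. *)
Lemma dotp_contraction_fixpoint (R : realType) m (T : 'cV[R]_m -> 'cV[R]_m)
    (q r : R) : 0 <= r -> q < 1 ->
  (forall i, continuous (fun t : 'rV_m => T t^T i 0)) ->
  (forall s, dotp s s <= r -> dotp (T s) (T s) <= r) ->
  (forall s t, dotp s s <= r -> dotp t t <= r ->
     dotp (T s - T t) (T s - T t) <= q * dotp (s - t) (s - t)) ->
  exists s, T s = s.
Proof.
move=> r0 q1 cT Tball Tcontr.
pose d s := dotp (T s - s) (T s - s).
have [||s sr smin] := @dotp_shell_EVT_min R m d 0 r 0.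
- have cTB i : continuous (fun t : 'rV[R]_m => (T t^T - t^T) i 0).
    rewrite (_ : (fun t : 'rV[R]_m => _) = (fun t => T t^T i 0 - t^T i 0)).
      move=> t; exact: (@continuousB R R^o _ _ _ t (cT i t)
        (@continuous_trmx_coord R m i t)).
    by apply/funext => t; rewrite !mxE.
  exact: continuous_dotp.
- by rewrite dotp0l lexx.
(* At a minimum [s] of [|T s - s|], moving to [T s] cannot decrease it. *)
exists s; apply/eqP; rewrite -subr_eq0; apply/eqP/dotp_eq0.
have {}sr : dotp s s <= r by case/andP: sr.
have := smin (T s); rewrite dotp_ge0 Tball // => /(_ isT).
have := Tcontr _ _ (Tball _ sr) sr; rewrite -/(d s) -/(d (T s)).
have := dotp_ge0 (T s - s); rewrite -/(d s); nra.
Qed.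

(** The deterministic half: a Newton-like correction turns an approximate solution [x0] with nearly
    orthonormal [A k *m x0] into an exact one. *)
Lemma quadratic_system_solvable (R : realType) m n (A : 'I_m -> 'M[R]_n)
    (b : 'I_m -> R) (c : R) (x0 : 'cV_n) :
  0 <= c -> c * m%:R <= 160^-1 ->
  (forall k, (A k)^T = A k) ->
  (forall u, \sum_k dotp (A k *m u) (A k *m u) <= c * dotp u u) ->
  \sum_k (qform (A k) x0 - b k) ^+ 2 <= 4 * m%:R ->
  frob (\matrix_(i, j) dotp (A i *m x0) (A j *m x0) - 1%:M) <= 40^-1 ->
  exists x, forall k, qform (A k) x = b k.
Proof.
move=> c0 cm A_sym A_le F0_le; set G := \matrix_(i, j) _ => G_le.
(* [Y *m s] is the correction [y(s)]. *)
pose Y := \matrix_(i < n, k < m) (A k *m x0) i 0.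
have GE : G = Y^T *m Y.
  by apply/matrixP => i j; rewrite !mxE; apply: eq_bigr => k _; rewrite !mxE.
have G1_le s : dotp ((G - 1%:M) *m s) ((G - 1%:M) *m s) <= 40^-1 * dotp s s.
  by apply: le_trans (dotp_mulmx_frob _ _) _; rewrite ler_wpM2r ?dotp_ge0.
(* [G] is the Gram matrix of the columns of [Y], so [|Y s|^2 = <s, G s>], and [G] is close to the
   identity. *)
have Y_le s : dotp (Y *m s) (Y *m s) <= 2 * dotp s s.
  have -> : dotp (Y *m s) (Y *m s) = dotp s s + dotp s ((G - 1%:M) *m s).
    by rewrite -dotpDr mulmxBl mul1mx addrC subrK GE -mulmxA dotp_mulmxl.
  have := dotp_ge0 (s - (G - 1%:M) *m s).
  have := G1_le s; have := dotp_ge0 s.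
  move: ((G - 1%:M) *m s) => z; rewrite !dotp_lin (dotpC z s); lra.
pose F0 := \col_k (qform (A k) x0 - b k).
have {}F0_le : dotp F0 F0 <= 4 * m%:R.
  by apply: le_trans F0_le; apply: ler_sum => k _; rewrite mxE expr2.
pose q u v := \col_k dotp (A k *m u) v.
have q_le u v : dotp (q u v) (q u v) <= c * dotp u u * dotp v v.
  apply: le_trans (ler_wpM2r (dotp_ge0 v) (A_le u)).
  rewrite mulr_suml; apply: ler_sum => k _; rewrite mxE -expr2.
  exact: dotp_CauchySchwarz.
(* Difference of squares, valid because each [A k] is symmetric; it yields the Lipschitz bound for
   the quadratic term. *)
have q_sub u v : q u u - q v v = q (u - v) (u + v).
  apply/colP => k; rewrite !mxE mulmxBr !dotp_lin.
  by rewrite (dotp_mulmxl (A k) u v) A_sym (dotpC u); lra.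
(* [T s = s] is half of [F0 + 2 G s + q (Y s) (Y s) = 0], with [G s] split as [s + (G - 1) s]. *)
pose T s := - 2^-1 *: F0 - (G - 1%:M) *m s - 2^-1 *: q (Y *m s) (Y *m s).
have T_sub s t : T s - T t =
    - ((G - 1%:M) *m (s - t) + 2^-1 *: q (Y *m (s - t)) (Y *m (s + t))).
  rewrite (mulmxBr Y) (mulmxDr Y) -q_sub mulmxBr /T.
  by apply/colP => k; rewrite !mxE; lra.
(* On the ball [|Y (s + t)|^2 <= 2 * 16m = 32m]. The linear part contributes [2 / 40] and the
   quadratic part [(1/2) * 2 * 32 / 160]; together they make exactly [1/4]. *)
have T_contr s t : dotp s s <= 4 * m%:R -> dotp t t <= 4 * m%:R ->
    dotp (T s - T t) (T s - T t) <= 4^-1 * dotp (s - t) (s - t).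
  move=> sr tr; rewrite T_sub !(dotpNl, dotpNr) opprK.
  apply: le_trans (dotp_sqrD _ _) _; rewrite [X in _ + 2 * X]dotpZl dotpZr.
  have := G1_le (s - t); have := Y_le (s - t); have := Y_le (s + t).
  have := q_le (Y *m (s - t)) (Y *m (s + t)).
  have := dotp_sqrD s t.
  have := dotp_ge0 (Y *m (s - t)); have := dotp_ge0 (Y *m (s + t)).
  have := dotp_ge0 (s - t).
  set d := dotp (s - t) _; set e := dotp (s + t) _.
  set g := dotp (_ *m (s - t)) ((G - _) *m _).
  set yd := dotp (Y *m (s - t)) _; set ye := dotp (Y *m (s + t)) _.
  set Q := dotp (q _ _) _.
  move=> d0 ye0 yd0 e_le Q_le ye_le yd_le g_le.
  have ye_le' : ye <= 32 * m%:R by lra.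
  have : c * yd * ye <= c * (2 * d) * (32 * m%:R).
    by rewrite ler_pM ?mulr_ge0 // ler_wpM2l.
  have : c * m%:R * d <= 160^-1 * d by rewrite ler_wpM2r.
  lra.
(* Since [|T 0|^2 = |F0|^2 / 4 <= m], the bound is [2 * (1/4) * 4m + 2m = 4m], so the ball is
   preserved. *)
have T_ball s : dotp s s <= 4 * m%:R -> dotp (T s) (T s) <= 4 * m%:R.
  move=> sr; have T0 : T 0 = - 2^-1 *: F0.
    rewrite /T !mulmx0 subr0 (_ : q 0 0 = 0) ?scaler0 ?subr0 //.
    by apply/colP => k; rewrite !mxE mulmx0 dotp0l.
  rewrite -[T s](addrNK (T 0)); apply: le_trans (dotp_sqrD _ _) _.
  have := T_contr s 0 sr; rewrite subr0.
  rewrite [dotp 0 0]dotp0l.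
  rewrite T0 [dotp (_ *: F0) _]dotpZl dotpZr mulr_ge0 ?ler0n // => /(_ isT).
  lra.
have [s Ts] : exists s, T s = s.
  apply: (@dotp_contraction_fixpoint _ _ T 4^-1 (4 * m%:R)) => //.
  - by rewrite mulr_ge0.
  - by lra.
  move=> i.
  have ct j : continuous (fun t : 'rV[R]_m => t^T j 0).
    exact: continuous_trmx_coord.
  have cY j : continuous (fun t : 'rV[R]_m => (Y *m t^T) j 0).
    exact: continuous_mulmx.
  have cG : continuous (fun t : 'rV[R]_m => ((G - 1%:M) *m t^T) i 0).
    exact: continuous_mulmx.
  have cq : continuous
      (fun t : 'rV[R]_m => dotp (A i *m (Y *m t^T)) (Y *m t^T)).
    by apply: continuous_dotp => //; exact: continuous_mulmx.
  rewrite (_ : (fun t : 'rV[R]_m => _) = (fun t => - 2^-1 * F0 i 0 -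
    ((G - 1%:M) *m t^T) i 0 - 2^-1 * dotp (A i *m (Y *m t^T)) (Y *m t^T))).
    move=> t.
    have c1 := @continuousB R R^o _ _ _ t
      (@cst_continuous _ R^o (- 2^-1 * F0 i 0) t) (cG t).
    have c2 := @continuousM R _ _ _ t (@cst_continuous _ R 2^-1 t) (cq t).
    exact: (@continuousB R R^o _ _ _ t c1 c2).
  by apply/funext => t; rewrite /T !mxE; lra.
exists (x0 + Y *m s) => k.
have := congr1 (fun z : 'cV_m => z k 0) Ts.
rewrite /T mulmxBl mul1mx GE -mulmxA !mxE.
(* Entry [k] of [Y^T Y s] is half the cross term in the expansion of [qform (A k) (x0 + Y s)]. *)
rewrite [X in _ - (X - _)](_ : _ = dotp (A k *m x0) (Y *m s)); last first.
  by apply: eq_bigr => i _; rewrite !mxE.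
rewrite /qform mulmxDr !dotp_lin (dotp_mulmxl (A k) (Y *m s) x0) A_sym.
rewrite (dotpC (Y *m s)).
lra.
Qed.

(** * Moments of random sign vectors, with sums over all sign patterns in place of expectations *)

Section RandomSigns.
Variables (R : realType) (n : nat).
Implicit Types (f : {ffun 'I_n -> bool}) (i j k l : 'I_n).

Definition sgnv f : 'cV[R]_n := \col_i (-1) ^+ f i.

Let flip i f : {ffun 'I_n -> bool} := [ffun j => (j == i) (+) f j].

Let flipK i : involutive (flip i).
Proof. by move=> f; apply/ffunP => j; rewrite !ffunE addbA addbb. Qed.

Let sgnv_flip i f j : sgnv (flip i f) j 0 = (-1) ^+ (j == i) * sgnv f j 0.
Proof. by rewrite !mxE ffunE signr_addb. Qed.

(** Flipping one sign permutes the patterns, so the sum equals its own negative. *)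
Let sum_odd i (g : {ffun 'I_n -> bool} -> R) :
  (forall f, g (flip i f) = - g f) -> \sum_f g f = 0.
Proof.
move=> g_odd; suff : \sum_f g f = - \sum_f g f by lra.
rewrite {1}(reindex_inj (inv_inj (flipK i))) -sumrN.
by apply: eq_bigr => f _; exact: g_odd.
Qed.

Lemma sgnv_sqr f i : sgnv f i 0 * sgnv f i 0 = 1.
Proof. by rewrite mxE -expr2 sqrr_sign. Qed.

(** If [{i, j}] and [{k, l}] differ, some index occurs exactly once and flipping its sign makes the
    summand odd. Otherwise every sign is squared and the summand is 1. *)
Lemma sum_sgnv4 i j k l : i != j -> k != l ->
  \sum_f sgnv f i 0 * sgnv f j 0 * (sgnv f k 0 * sgnv f l 0) =
  #|{ffun 'I_n -> bool}|%:R *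
    (((i == k) && (j == l))%:R + ((i == l) && (j == k))%:R).
Proof.
move=> ij kl.
have sum1 : \sum_(f : {ffun 'I_n -> bool}) (1 : R) = #|{ffun 'I_n -> bool}|%:R.
  by rewrite sumr_const.
have [ik|ik] := eqVneq i k; have [il|il] := eqVneq i l.
- by move: kl; rewrite -ik -il eqxx.
- have [jl|jl] := eqVneq j l.
    rewrite /= addr0 mulr1 -sum1; apply: eq_bigr => f _.
    by rewrite -ik -jl mulrACA !sgnv_sqr mulr1.
  rewrite /= addr0 mulr0; apply: (@sum_odd j) => f.
  rewrite !sgnv_flip -ik eqxx (negPf ij) [l == j]eq_sym (negPf jl).
  by rewrite !mul1r; ring.
- have [jk|jk] := eqVneq j k.
    rewrite /= add0r mulr1 -sum1; apply: eq_bigr => f _.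
    by rewrite -il -jk [X in _ * X]mulrC mulrACA !sgnv_sqr mulr1.
  rewrite /= addr0 mulr0; apply: (@sum_odd j) => f.
  rewrite !sgnv_flip -il eqxx (negPf ij) [k == j]eq_sym (negPf jk).
  by rewrite !mul1r; ring.
rewrite /= addr0 mulr0; apply: (@sum_odd i) => f.
rewrite !sgnv_flip eqxx [k == i]eq_sym (negPf ik) [l == i]eq_sym (negPf il).
by rewrite [j == i]eq_sym (negPf ij) !mul1r; ring.
Qed.

(** Squares of signs are 1, so the diagonal contributes exactly the trace. *)
Lemma qform_sgnv (B : 'M[R]_n) f : qform B (sgnv f) - \tr B =
  \sum_(p : 'I_n * 'I_n | p.1 != p.2)
     B p.1 p.2 * (sgnv f p.1 0 * sgnv f p.2 0).
Proof.
rewrite -(pair_big_dep xpredT (fun i j => i != j)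
  (fun i j => B i j * (sgnv f i 0 * sgnv f j 0))) /=.
rewrite /qform /dotp /mxtrace -sumrB; apply: eq_bigr => i _.
rewrite mxE mulr_suml (bigD1 i) //= -mulrA sgnv_sqr mulr1 addrAC subrr add0r.
by apply: eq_big => [j|j _]; [rewrite eq_sym|ring].
Qed.

(** In the expanded square, the fourth moments pair each off-diagonal position only with itself and
    with its transpose. The cross term [B i j * B j i] appears because [B] will be a product
    [A j *m A i], in general not symmetric. *)
Lemma sum_qform_sgnv_variance (B : 'M[R]_n) :
  \sum_f (qform B (sgnv f) - \tr B) ^+ 2 <=
  #|{ffun 'I_n -> bool}|%:R * (2 * frob B).
Proof.
set N := #|_|%:R.
pose offd (p : 'I_n * 'I_n) := p.1 != p.2.
pose swap (p : 'I_n * 'I_n) := (p.2, p.1).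
have -> : \sum_f (qform B (sgnv f) - \tr B) ^+ 2 =
    N * \sum_(p | offd p) (B p.1 p.2 ^+ 2 + B p.1 p.2 * B p.2 p.1).
  under eq_bigr => f _ do rewrite qform_sgnv expr2 mulr_suml.
  rewrite exchange_big mulr_sumr; apply: eq_bigr => -[i j] /= ij.
  under eq_bigr => f _ do rewrite mulr_sumr.
  rewrite exchange_big /=.
  under eq_bigr => p kl.
    under eq_bigr => f _ do rewrite mulrACA.
    rewrite -mulr_sumr sum_sgnv4 // -/N mulrCA mulrDr !mulr_natr.
    over.
  rewrite -mulr_sumr big_split /=; congr (_ * (_ + _)).
    rewrite (bigD1 (i, j)) //= !eqxx mulr1n big1 ?addr0 ?expr2 //.
    case=> k l /= /andP[_ ne]; case: eqP => [ik|]; case: eqP => [jl|] //=.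
    by move: ne; rewrite -ik -jl eqxx.
  rewrite (bigD1 (j, i)) /= 1?eq_sym // !eqxx mulr1n big1 ?addr0 //.
  case=> k l /= /andP[_ ne]; case: eqP => [il|]; case: eqP => [jk|] //=.
  by move: ne; rewrite -il -jk eqxx.
rewrite ler_wpM2l ?ler0n //.
have swapE : \sum_(p | offd p) B p.2 p.1 ^+ 2 =
    \sum_(p | offd p) B p.1 p.2 ^+ 2.
  rewrite (reindex_inj (h := swap)); last by move=> [? ?] [? ?] [-> ->].
  by apply: eq_bigl => p; rewrite /offd eq_sym.
have frobE : frob B = \sum_(p : 'I_n * 'I_n) B p.1 p.2 ^+ 2.
  by rewrite /frob pair_big.
(* The cross term is at most the mean of the two squares; by the symmetry [swap] these then add up
   to twice the off-diagonal part of [frob B]. *)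
apply: (@le_trans _ _ (\sum_(p | offd p)
    (3 / 2 * B p.1 p.2 ^+ 2 + 2^-1 * B p.2 p.1 ^+ 2))).
  by apply: ler_sum => p _; have := sqr_ge0 (B p.1 p.2 - B p.2 p.1); nra.
rewrite big_split -!mulr_sumr swapE frobE [X in _ <= _ * X](bigID offd) /=.
have : 0 <= \sum_(p | ~~ offd p) B p.1 p.2 ^+ 2.
  by apply: sumr_ge0 => p _; exact: sqr_ge0.
lra.
Qed.

End RandomSigns.

(** * Existence of an approximate solution by averaging *)

Lemma frob_trace (R : realType) n (M : 'M[R]_n) :
  M^T = M -> frob M = \tr (M *m M).
Proof.
move=> M_sym; apply: eq_bigr => i _; rewrite mxE; apply: eq_bigr => j _.
by rewrite -{3}M_sym mxE expr2.
Qed.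

Lemma frob_eq0 (R : realType) p n (M : 'M[R]_(p, n)) : frob M = 0 -> M = 0.
Proof.
rewrite /frob pair_big => /eqP.
rewrite psumr_eq0 => [/allP M0|? _]; last exact: sqr_ge0.
apply/matrixP => i j; rewrite mxE; apply/eqP.
by have := M0 (i, j) (mem_index_enum _); rewrite sqrf_eq0.
Qed.

Lemma frob_col (R : realType) p n (M : 'M[R]_(p, n)) :
  frob M = \sum_j dotp (col j M) (col j M).
Proof.
rewrite /frob exchange_big; apply: eq_bigr => j _; apply: eq_bigr => i _.
by rewrite !mxE expr2.
Qed.

Lemma exists_le_mean (R : realType) (T : finType) (g : T -> R) a :
  (0 < #|T|)%N -> \sum_t g t <= #|T|%:R * a -> exists t, g t <= a.
Proof.
case/card_gt0P => t0 _ g_le.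
have [/= t _ tmin] := @Order.TotalTheory.arg_minP _ _ _ t0 xpredT g isT.
exists t; have T0 : (0 : R) < #|T|%:R.
  by rewrite ltr0n; apply/card_gt0P; exists t0.
rewrite -(ler_pM2l T0) (le_trans _ g_le) // mulr_natl -sumr_const.
by apply: ler_sum => u _; exact: tmin.
Qed.

(** Both bounds must hold at the same sign vector, so one weighted sum of the two nonnegative errors
    is averaged. *)
Lemma exists_approximate_solution (R : realType) m n (A : 'I_m -> 'M[R]_n)
    (c : R) :
  (0 < m)%N -> 0 <= c -> c * m%:R <= 160^-1 ->
  (forall k, (A k)^T = A k) ->
  (forall i j, \tr (A i *m A j) = (i == j)%:R) ->
  (forall u, \sum_k dotp (A k *m u) (A k *m u) <= c * dotp u u) ->
  exists2 x : 'cV_n, \sum_k (qform (A k) x - \tr (A k)) ^+ 2 <= 4 * m%:R &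
    frob (\matrix_(i, j) dotp (A i *m x) (A j *m x) - 1%:M) <= 40^-1.
Proof.
move=> m0 c0 cm A_sym A_orth A_le.
have {}m0 : (0 : R) < m%:R by rewrite ltr0n.
have frobA k : frob (A k) = 1 by rewrite frob_trace // A_orth eqxx.
have frobAM M : \sum_k frob (A k *m M) <= c * frob M.
  under eq_bigr => k _ do rewrite frob_col.
  rewrite exchange_big frob_col mulr_sumr; apply: ler_sum => j _ /=.
  apply: le_trans (A_le _); apply: ler_sum => k _.
  by rewrite !colE mulmxA.
pose G2 x := \sum_i \sum_j (qform (A j *m A i) x - \tr (A j *m A i)) ^+ 2.
pose F2 x := \sum_k (qform (A k) x - \tr (A k)) ^+ 2.
(* [<A i x, A j x>] is the form of [A j *m A i] at [x], and orthonormality makes the identity matrix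
   the matrix of traces: the variance bound applies entrywise. *)
have G2E x : frob (\matrix_(i, j) dotp (A i *m x) (A j *m x) - 1%:M) = G2 x.
  apply: eq_bigr => i _; apply: eq_bigr => j _; rewrite !mxE A_orth eq_sym.
  by rewrite /qform -mulmxA (dotp_mulmxl (A j)) A_sym.
set N := #|{ffun 'I_n -> bool}|.
have N0 : (0 < N)%N by apply/card_gt0P; exists [ffun=> true].
have F2_le : \sum_f F2 (sgnv R f) <= N%:R * (2 * m%:R).
  rewrite exchange_big /= (_ : _ * _ = \sum_(k < m) N%:R * (2 * frob (A k))).
    by apply: ler_sum => k _; exact: sum_qform_sgnv_variance.
  under eq_bigr => k _ do rewrite frobA.
  by rewrite sumr_const card_ord -[RHS]mulr_natr; ring.
have G2_le : \sum_f G2 (sgnv R f) <= N%:R * (2 * 160^-1).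
  apply: (@le_trans _ _ (\sum_i \sum_j N%:R * (2 * frob (A j *m A i)))).
    rewrite exchange_big; apply: ler_sum => i _; rewrite exchange_big.
    by apply: ler_sum => j _; exact: sum_qform_sgnv_variance.
  under eq_bigr => i _ do rewrite -!mulr_sumr.
  rewrite -!mulr_sumr ler_wpM2l ?ler0n // ler_wpM2l ?ler0n //.
  apply: le_trans cm; rewrite mulr_natr -[X in _ *+ X]card_ord -sumr_const.
  by apply: ler_sum => i _; rewrite (le_trans (frobAM _ _)) // frobA mulr1.
(* The weight [160 m] gives the mean bound [2m + 160m * 2/160 = 4m]. Dropping either summand leaves
   [F2 <= 4m] and [G2 <= 4/160 = 1/40]. *)
have [||f] := @exists_le_mean R _
  (fun f => F2 (sgnv R f) + 160 * m%:R * G2 (sgnv R f)) (4 * m%:R).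
- exact: N0.
- rewrite big_split -mulr_sumr /=.
  have := ler_wpM2l (_ : 0 <= 160 * m%:R) G2_le.
  rewrite mulr_ge0 ?ler0n // => /(_ isT); rewrite -/N; lra.
have F2_ge0 x : 0 <= F2 x by apply: sumr_ge0 => k _; exact: sqr_ge0.
have G2_ge0 x : 0 <= m%:R * G2 x.
  rewrite mulr_ge0 ?ler0n // sumr_ge0 // => i _.
  by apply: sumr_ge0 => j _; exact: sqr_ge0.
move=> f_le; exists (sgnv R f); rewrite ?G2E -/(F2 _).
  by have := G2_ge0 (sgnv R f); lra.
by rewrite -(ler_pM2l m0); have := F2_ge0 (sgnv R f); lra.
Qed.

(** * Orthonormal bases for the trace form *)

Definition mx_orthonormal (R : realType) n (s : seq 'M[R]_n) :=
  forall i j, (i < size s)%N -> (j < size s)%N ->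
    \tr (s`_i *m s`_j) = (i == j)%:R.

Lemma span_sym (R : realType) n (s : seq 'M[R]_n) :
  (forall X, X \in s -> X^T = X) -> forall X, X \in <<s>>%VS -> X^T = X.
Proof.
move=> s_sym X /(@coord_span _ _ _ (in_tuple s)) ->.
rewrite raddf_sum; apply: eq_bigr => i _; rewrite /= linearZ /=.
by congr (_ *: _); apply/s_sym/mem_nth.
Qed.

(** Gram-Schmidt, by induction on the list. The trace form is positive definite on symmetric
    matrices but not on all matrices, so symmetry of the span is used to normalise the residual. *)
Lemma exists_mx_orthonormal (R : realType) n (s : seq 'M[R]_n) :
  (forall X, X \in s -> X^T = X) -> free s ->
  exists t, [/\ size t = size s, <<t>>%VS = <<s>>%VS & mx_orthonormal t].
Proof.
elim: s => [|X s IHs] s_sym; first by exists [::].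
rewrite free_cons => /andP[Xs s_free].
have [|t [size_t span_t t_orth]] := IHs _ s_free.
  by move=> Y Ys; apply: s_sym; rewrite inE Ys orbT.
(* [P] is the projection of [X] to the span of [t]; the residual [Y] is nonzero by freeness. *)
pose P := \sum_(i < size t) \tr (X *m t`_i) *: t`_i; pose Y := X - P.
have Pt : P \in <<t>>%VS.
  by apply: memv_suml => i _; rewrite memvZ // memv_span // mem_nth.
have t_sym Z : Z \in <<t>>%VS -> Z^T = Z.
  rewrite span_t; apply: span_sym => W Ws.
  by apply: s_sym; rewrite inE Ws orbT.
have Y_sym : Y^T = Y.
  by rewrite linearB /= (t_sym P Pt) s_sym // mem_head.
have Y0 : Y != 0.
  by apply: contraNneq Xs => /eqP; rewrite subr_eq0 -span_t => /eqP ->.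
have YY0 : 0 < \tr (Y *m Y).
  rewrite -frob_trace // lt_def; apply/andP; split.
    by apply: contraNneq Y0 => /frob_eq0 ->.
  by apply: sumr_ge0 => i _; apply: sumr_ge0 => j _; exact: sqr_ge0.
pose r := Num.sqrt (\tr (Y *m Y)).
have r0 : r != 0 by rewrite gt_eqF // sqrtr_gt0.
have Yt i : (i < size t)%N -> \tr (Y *m t`_i) = 0.
  move=> i_lt; suff : \tr (P *m t`_i) = \tr (X *m t`_i).
    by rewrite mulmxBl linearB /= => ->; rewrite subrr.
  rewrite mulmx_suml raddf_sum (bigD1 (Ordinal i_lt)) //= big1 => [|j].
    by rewrite addr0 -scalemxAl linearZ /= t_orth // eqxx mulr1.
  rewrite -val_eqE /= => ji.
  by rewrite -scalemxAl linearZ /= t_orth // (negPf ji) mulr0.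
exists (r^-1 *: Y :: t); split; first by rewrite /= size_t.
  apply/eqP; rewrite eqEsubv !span_cons -span_t !subv_add !addvSr !andbT.
  apply/andP; split.
    rewrite -memvE memvZ // memvB //; last by rewrite (subvP (addvSr _ _)).
    by rewrite (subvP (addvSl _ _)) // memv_line.
  have XE : X = r *: (r^-1 *: Y) + P by rewrite scalerA divff // scale1r subrK.
  by rewrite -memvE [Z in Z \in _]XE memv_add // memvZ // memv_line.
move=> [|i] [|j] /= i_lt j_lt.
- rewrite -scalemxAl -scalemxAr !linearZ /= -[\tr (Y *m Y)]sqr_sqrtr ?ltW //.
  by rewrite -/r; field.
- by rewrite -scalemxAl linearZ /= Yt // mulr0.
- by rewrite -scalemxAr linearZ /= mxtrace_mulC Yt // mulr0.
- by rewrite t_orth.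
Qed.

Lemma exists_mx_orthonormal_basis (R : realType) m n (Q : m.-tuple 'M[R]_n) :
  (forall i, (tnth Q i)^T = tnth Q i) -> free Q ->
  exists A : m.-tuple 'M[R]_n, mx_orthonormal_basis <<Q>>%VS A.
Proof.
move=> Q_sym Q_free.
have [|t [size_t span_t t_orth]] := exists_mx_orthonormal _ Q_free.
  by move=> X /tnthP[i ->].
rewrite size_tuple in size_t; exists (tcast size_t (in_tuple t)).
split; first rewrite val_tcast basisEdim.
  by rewrite span_t subvv size_t /= (eqnP Q_free) size_tuple.
move=> i j; rewrite !(tnth_nth 0) val_tcast /=.
by rewrite t_orth // size_t.
Qed.

Lemma mx_orthonormal_basis_expansion (R : realType) m n (V : {vspace 'M[R]_n})
    (A : m.-tuple 'M[R]_n) X :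
  mx_orthonormal_basis V A -> X \in V ->
  X = \sum_i \tr (X *m tnth A i) *: tnth A i.
Proof.
move=> [A_basis A_orth] XV; rewrite {1}(coord_basis A_basis XV).
apply: eq_bigr => i _; rewrite -tnth_nth; congr (_ *: _).
rewrite {2}(coord_basis A_basis XV) mulmx_suml raddf_sum (bigD1 i) //=.
rewrite big1 => [|j ji]; rewrite -tnth_nth -scalemxAl linearZ /= A_orth.
  by rewrite eqxx mulr1 addr0.
by rewrite (negPf ji) mulr0.
Qed.

(** The change of basis [U] is orthogonal. Expanding each [B j] in the [A i], the products
    [A i *m A k] get the coefficients of [U^T U = 1], so only squares remain. *)
Lemma sum_squares_basis_indep (R : realType) m n (V : {vspace 'M[R]_n})
    (A B : m.-tuple 'M[R]_n) :
  mx_orthonormal_basis V A -> mx_orthonormal_basis V B ->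
  sum_squares A = sum_squares B.
Proof.
move=> hA hB.
have BV i : tnth B i \in V := basis_mem hB.1 (mem_tnth i B).
pose U := \matrix_(j, i) \tr (tnth B j *m tnth A i).
have BE j : tnth B j = \sum_i U j i *: tnth A i.
  rewrite {1}(mx_orthonormal_basis_expansion hA (BV j)).
  by apply: eq_bigr => i _; rewrite mxE.
(* Orthonormality of [B] gives [U U^T = 1]; as [U] is square, [U^T U = 1] follows. *)
have /mulmx1C UU : U *m U^T = 1%:M.
  apply/matrixP => j k; rewrite !mxE -hB.2 (BE k) mulmx_sumr raddf_sum.
  by apply: eq_bigr => i _; rewrite -scalemxAr /= linearZ /= !mxE mulrC.
rewrite /sum_squares.
transitivity (\sum_i \sum_k (U^T *m U) i k *: (tnth A i *m tnth A k)).
  apply: eq_bigr => i _; rewrite UU (bigD1 i) //= big1 => [|k ki].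
    by rewrite mxE eqxx scale1r addr0.
  by rewrite mxE eq_sym (negPf ki) scale0r.
under eq_bigr => i _ do under eq_bigr => k _ do rewrite mxE scaler_suml.
under eq_bigr => i _ do rewrite exchange_big.
rewrite exchange_big; apply: eq_bigr => j _ /=.
rewrite {1}(BE j) mulmx_suml; apply: eq_bigr => i _.
rewrite (BE j) mulmx_sumr; apply: eq_bigr => k _.
by rewrite mxE -scalemxAl -scalemxAr scalerA.
Qed.

Theorem theorem1p1 (R : realType) :
  exists eta : R, 0 < eta /\
  forall (m n : nat), (3 <= m)%N -> (0 < n)%N ->
  forall Q : m.-tuple 'M[R]_n,
    (forall i : 'I_m, (tnth Q i)^T = tnth Q i) ->
    free Q ->
    ((exists A : m.-tuple 'M[R]_n, mx_orthonormal_basis <<Q>>%VS A /\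
        opnorm (sum_squares A) <= eta / m%:R)
     <->
     (forall A : m.-tuple 'M[R]_n, mx_orthonormal_basis <<Q>>%VS A ->
        opnorm (sum_squares A) <= eta / m%:R))
    /\
    ((exists A : m.-tuple 'M[R]_n, mx_orthonormal_basis <<Q>>%VS A /\
        opnorm (sum_squares A) <= eta / m%:R) ->
     exists x : 'cV[R]_n,
       forall i : 'I_m, qform (tnth Q i) x = \tr (tnth Q i)).
Proof.
exists 160^-1; split; first by lra.
move=> m n m3 _ Q Q_sym Q_free; split; first split.
- by move=> [A [hA A_le]] B hB; rewrite (sum_squares_basis_indep hB hA).
(* A basis must exist for the universal condition to yield one. *)
- move=> all_le; have [A hA] := exists_mx_orthonormal_basis Q_sym Q_free.
  by exists A; split=> //; exact: all_le.
move=> [A [hA S_le]].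
have m0 : (0 < m)%N by apply: leq_trans m3.
have mR : (0 : R) < m%:R by rewrite ltr0n.
pose c : R := 160^-1 / m%:R.
have c0 : 0 <= c by rewrite divr_ge0 ?invr_ge0 ?ler0n.
have cm : c * m%:R <= 160^-1 by rewrite divfK // gt_eqF.
have A_sym k : (tnth A k)^T = tnth A k.
  apply: (@span_sym _ _ Q); first by move=> X /tnthP[i ->].
  exact: basis_mem hA.1 (mem_tnth k A).
have S_sym : (sum_squares A)^T = sum_squares A.
  rewrite /sum_squares raddf_sum; apply: eq_bigr => k _.
  by rewrite /= trmx_mul !A_sym.
have A_le u : \sum_k dotp (tnth A k *m u) (tnth A k *m u) <= c * dotp u u.
  apply: (@le_trans _ _ (opnorm (sum_squares A) * dotp u u)); last first.
    by rewrite ler_wpM2r ?dotp_ge0.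
  apply: le_trans (dotp_mulmx_le_opnorm u S_sym).
  (* By symmetry of the [A k], the sum of [|A k u|^2] is the quadratic form of [sum_squares A] at
     [u]. *)
  rewrite /sum_squares mulmx_suml dotp_suml; apply: ler_sum => k _.
  by rewrite dotp_mulmxl A_sym mulmxA dotpC.
have [x0 F_le G_le] := exists_approximate_solution m0 c0 cm A_sym hA.2 A_le.
have [x xA] := quadratic_system_solvable c0 cm A_sym A_le F_le G_le.
(* Both sides of the equation are linear in the matrix, so solving it for the basis [A] solves it on
   the whole span. *)
exists x => i; have QV : tnth Q i \in <<Q>>%VS := memv_span (mem_tnth i Q).
rewrite (mx_orthonormal_basis_expansion hA QV) raddf_sum /qform mulmx_suml.
rewrite dotp_suml; apply: eq_bigr => k _.
by rewrite -scalemxAl dotpZl /= linearZ /= -xA.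
Qed.
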